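(* Let $U$ be a bilateral shift of multiplicity one on a complex Hilbert space $H$, and let $\lambda$ be a complex number with $\lambda\ne 1$. Then the equation $(I-U^* )X=\lambda X(I-U^* )$, for bounded linear operators $X$ on $H$, has only the trivial solution $X=0$.
   Context: A bounded linear operator $U$ on a complex Hilbert space $H$ is a bilateral shift of multiplicity one if there is an orthonormal basis $(e_n)_{n\in\mathbb Z}$ of $H$ such that $Ue_n=e_{n+1}$ for all $n\in\mathbb Z$. *)

(* Defs.v *)
From HB Require Import structures.
From mathcomp Require Import all_boot all_order all_algebra.
From mathcomp Require Import all_classical all_reals all_analysis.
From mathcomp Require Export complex.

Set Implicit Arguments.
Unset Strict Implicit.
Unset Printing Implicit Defensive.

Import Order.TTheory GRing.Theory Num.Theory Num.Def.
Import numFieldNormedType.Exports.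
Local Open Scope classical_set_scope.
Local Open Scope ring_scope.

(* A complex Hilbert space is a complete normed R[i]-module H with an inner
   product dot : {dot H for conjC}, linear in its first argument and
   conjugate-linear in its second, which induces the norm. *)
Definition induces_norm (R : realType) (H : completeNormedModType R[i])
    (dot : {dot H for conjC}) : Prop :=
  forall x : H, `|x| ^+ 2 = dot x x.

Definition bounded_operator (R : realType) (H : completeNormedModType R[i])
    (T : {linear H -> H}) : Prop :=
  exists M : R[i], forall x : H, `|T x| <= M * `|x|.

(* adjoint dot T y is the vector z such that dot (T x) y = dot x z for all x.
   It is unique, and when T is bounded and dot induces the norm it exists by
   the Riesz representation theorem; the default 0 is then never used. *)
Definition adjoint (R : realType) (H : completeNormedModType R[i])
    (dot : {dot H for conjC}) (T : {linear H -> H}) : H -> H :=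
  fun y => xget 0 [set z | forall x, dot (T x) y = dot x z].

Definition lin_span (R : realType) (H : completeNormedModType R[i])
    (e : int -> H) : set H :=
  [set x | exists (s : seq int) (a : int -> R[i]),
             x = \sum_(n <- s) a n *: e n].

Definition orthonormal_basis (R : realType) (H : completeNormedModType R[i])
    (dot : {dot H for conjC}) (e : int -> H) : Prop :=
  (forall m n, dot (e m) (e n) = (m == n)%:R) /\
  closure (lin_span e) = [set: H].

Definition bilateral_shift (R : realType) (H : completeNormedModType R[i])
    (dot : {dot H for conjC}) (U : {linear H -> H}) : Prop :=
  bounded_operator U /\
  exists e : int -> H,
    orthonormal_basis dot e /\ forall n : int, U (e n) = e (n + 1).

(* Main.v *)
(* With V = U^* and x_n = X e_n, the equation reads (V - (1 - lambda)) x_n =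
   lambda x_(n-1); so, for lambda <> 0, (x_n) is a bounded two-sided orbit of
   the normal operator G = (V - (1 - lambda)) / lambda, and |x_n|^2 is a bounded
   function of n in Z with second difference |G^* G x_n - x_n|^2 >= 0. A bounded
   convex function on Z is constant, hence G^* G x_n = x_n. This factors as
   (U - 1) (mu U - mu^* ) x_n = 0 where mu = 1 - lambda <> 0, and by Bessel's
   inequality the shift U has no eigenvectors, so x_n = 0 for all n. *)
Require Import Defs.
From HB Require Import structures.
From mathcomp Require Import all_boot all_order all_algebra.
From mathcomp Require Import all_classical all_reals all_analysis.
From mathcomp Require Import ring lra zify.

Set Implicit Arguments.
Unset Strict Implicit.
Unset Printing Implicit Defensive.

Import Order.TTheory GRing.Theory Num.Theory Num.Def.
Import numFieldNormedType.Exports.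
Local Open Scope ring_scope.

(** * Bounded convex sequences, dense sets and isometries *)

(** A positive first step would, by convexity, bound all later steps from below, so [b] would grow
    linearly past [M]. *)
Lemma convex_bounded_le (R : realType) (b : nat -> R) (M : R) :
  (forall k, 0 <= b k.+2 - b k.+1 *+ 2 + b k) -> (forall k, b k <= M) ->
  b 1%N <= b 0%N.
Proof.
move=> bconv bM; rewrite leNgt; apply/negP => b01.
have d_gt0 : 0 < b 1%N - b 0%N by rewrite subr_gt0.
have step k : b 1%N - b 0%N <= b k.+1 - b k.
  elim: k => // k IHk; apply: (le_trans IHk).
  have := bconv k; lra.
have grow k : b 0%N + (b 1%N - b 0%N) *+ k <= b k.
  elim: k => [|k IHk]; first by rewrite mulr0n addr0.
  have := step k; rewrite mulrS; lra.
have := archi_boundP (divr_ge0 (_ : 0 <= `|M - b 0%N|) (ltW d_gt0)).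
rewrite normr_ge0 => /(_ isT); set k := Num.bound _.
rewrite ltr_pdivrMr// mulrC mulr_natr => Mk.
have := le_lt_trans (ler_norm _) Mk; have := grow k; have := bM k; lra.
Qed.

Lemma bounded_continuous (K : numFieldType) (V W : normedModType K)
    (T : {linear V -> W}) (M : K) :
  (forall x, `|T x| <= M * `|x|) -> continuous T.
Proof.
move=> TM; apply: bounded_linear_continuous; apply/bounded_funP => r.
(* [M] has no assumed sign, but its product with the norm of [x] bounds a norm, hence equals its own
   absolute value. *)
exists (`|M| * r) => x xr; rewrite -normr_id (le_trans _ (ler_wpM2l _ xr))//.
rewrite -[X in _ * X]normr_id -normrM.
by rewrite !ger0_norm//; exact: le_trans (TM x).
Qed.

Lemma eq_on_dense (T : topologicalType) (K : numFieldType) (V : normedModType K)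
    (f g : T -> V) (A : set T) :
  continuous f -> continuous g -> closure A = [set: T]%classic ->
  (forall x, A x -> f x = g x) -> f =1 g.
Proof.
move=> fc gc Ad fg x; apply/eqP; rewrite -subr_eq0; apply/eqP.
have cl : closed ((fun y => f y - g y) @^-1` [set 0])%classic.
  apply: preimage_closed.
    by move=> y _; apply: continuousB; [exact: fc|exact: gc].
  exact/accessible_closed_set1/hausdorff_accessible/norm_hausdorff.
apply: cl; rewrite -/(closure _ x).
have : closure A x by rewrite Ad.
by apply: closure_subset => y Ay /=; rewrite fg// subrr.
Qed.

(** The range is closed: the preimages of the neighbourhoods of [y] generate a Cauchy filter, and
    [T] sends its limit to [y]. *)
Lemma isometry_dense_range_surj (K : numFieldType) (V : completeNormedModType K)
    (T : {linear V -> V}) (A : set V) :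
  (forall x, `|T x| = `|x|) -> closure A = [set: V]%classic ->
  (forall y, A y -> exists x, T x = y) -> forall y, exists x, T x = y.
Proof.
move=> Tiso Ad AT y.
have Tc : continuous T.
  by apply: (@bounded_continuous _ _ _ _ 1) => x; rewrite Tiso mul1r.
have rngT (B : set V) : nbhs y B -> exists x, B (T x).
  move=> yB; have : closure A y by rewrite Ad.
  move=> /(_ _ yB) [z [/AT[x <-] Bx]]; by exists x.
pose F := filter_from (nbhs y) (fun B => T @^-1` B)%classic.
(* Density of the range makes every preimage nonempty. *)
have FF : ProperFilter F.
  apply: filter_from_proper; last by move=> B /rngT[x Bx]; exists x.
  apply: filter_from_filter; first by exists setT; exact: filterT.
  move=> B C yB yC; exists (B `&` C)%classic; first exact: filterI.
  by rewrite preimage_setI.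
have FC : cauchy F.
  apply: cauchy_exP => e e0.
  have [x xy] := rngT _ (nbhsx_ballx y (e / 2) (divr_gt0 e0 (ltr0Sn _ 1))).
  exists x; exists (ball y (e / 2)).
    exact: nbhsx_ballx (divr_gt0 e0 (ltr0Sn _ 1)).
  move=> z /= zy; rewrite -ball_normE /= -Tiso linearB.
  by have := ball_splitr xy zy; rewrite -ball_normE.
have /cvg_ex [x Fx] : cvg F by exact: cauchy_cvg.
exists x; apply: (@cvg_unique _ (@norm_hausdorff _ V) (T @ F)%classic).
  exact: cvg_comp Fx (Tc x).
by move=> B yB; exists B.
Qed.

(** * Inner product identities and Bessel's inequality *)

Lemma dotZl (C : numClosedFieldType) (V : lmodType C)
    (dot : {dot V for conjC}) (a : C) (x y : V) : dot (a *: x) y = a * dot x y.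
Proof. exact: linearZl_LR. Qed.

Lemma dotZr (C : numClosedFieldType) (V : lmodType C)
    (dot : {dot V for conjC}) (a : C) (x y : V) :
  dot x (a *: y) = a^* * dot x y.
Proof. exact: linearZr_LR. Qed.

Lemma dotBl (C : numClosedFieldType) (V : lmodType C)
    (dot : {dot V for conjC}) (x y z : V) :
  dot (x - y) z = dot x z - dot y z.
Proof. exact: linearBl. Qed.

Lemma dotDr (C : numClosedFieldType) (V : lmodType C)
    (dot : {dot V for conjC}) (x y z : V) :
  dot x (y + z) = dot x y + dot x z.
Proof. exact: linearDr. Qed.

Lemma dot_suml (C : numClosedFieldType) (V : lmodType C)
    (dot : {dot V for conjC}) (I : Type) (s : seq I) (f : I -> V) (z : V) :
  dot (\sum_(i <- s) f i) z = \sum_(i <- s) dot (f i) z.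
Proof. exact: linear_sumlz. Qed.

Lemma dot_sumr (C : numClosedFieldType) (V : lmodType C)
    (dot : {dot V for conjC}) (I : Type) (s : seq I) (f : I -> V) (z : V) :
  dot z (\sum_(i <- s) f i) = \sum_(i <- s) dot z (f i).
Proof. exact: linear_sumr. Qed.

Lemma dot_sum (C : numClosedFieldType) (V : lmodType C)
    (dot : {dot V for conjC}) (I : Type) (s : seq I) (a : I -> C) (f : I -> V) :
  dot (\sum_(i <- s) a i *: f i) (\sum_(j <- s) a j *: f j) =
  \sum_(i <- s) \sum_(j <- s) a i * ((a j)^* * dot (f i) (f j)).
Proof.
rewrite dot_suml; apply: eq_bigr => i _.
by rewrite dot_sumr; apply: eq_bigr => j _; rewrite dotZl dotZr.
Qed.

(** Expanding at [x + y] matches the real parts of the two products; replacing [x] by ['i *: x]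
    matches the imaginary parts. *)
Lemma dot_polarization (C : numClosedFieldType) (V : lmodType C)
    (dot : {dot V for conjC}) (T : {linear V -> V}) :
  (forall x, dot (T x) (T x) = dot x x) ->
  forall x y, dot (T x) (T y) = dot x y.
Proof.
move=> Tdot.
have re x y : dot (T x) (T y) + (dot (T x) (T y))^* = dot x y + (dot x y)^*.
  have := Tdot (x + y); rewrite linearD !dnormD !Tdot; exact: addrI.
move=> x y; have := re ('i *: x) y; have := re x y.
rewrite linearZ !dotZl !rmorphM /= conjCi.
set d := dot (T x) (T y); set c := dot x y => h1 h2.
have h3 : d - d^* = c - c^*.
  by apply: (mulfI (neq0Ci C)); move: h2; rewrite !mulNr !mulrBr.
have : d *+ 2 = c *+ 2.
  have -> : d *+ 2 = (d + d^*) + (d - d^*) by ring.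
  by rewrite h1 h3; ring.
by move/eqP; rewrite eqrMn2r// => /eqP.
Qed.

(** [p] is the orthogonal projection of [z] on the span of the first [N] vectors, and
    [dot (z - p) (z - p)] equals [dot z z - S]. *)
Lemma bessel (C : numClosedFieldType) (V : lmodType C)
    (dot : {dot V for conjC}) (f : nat -> V) (z : V) (N : nat) :
  (forall k l, dot (f k) (f l) = (k == l)%:R) ->
  \sum_(k < N) `|dot z (f k)| ^+ 2 <= dot z z.
Proof.
move=> fo; pose p := \sum_(k < N) dot z (f k) *: f k.
set S := \sum_(k < N) _.
have zp : dot z p = S.
  by rewrite dot_sumr; apply: eq_bigr => k _; rewrite dotZr normCKC.
have pp : dot p p = S.
  rewrite dot_sum; apply: eq_bigr => k _.
  rewrite (bigD1 k)//= big1 ?addr0; first by rewrite fo eqxx mulr1 normCK.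
  by move=> l lk; rewrite fo val_eqE eq_sym (negPf lk) !mulr0.
have S_ge0 : 0 <= S by apply: sumr_ge0 => k _; exact: exprn_ge0.
have := dnorm_ge0 dot (z - p).
by rewrite dnormB pp zp conj_Creal ?ger0_real// addrKA subr_ge0.
Qed.

(** * From nonnegative complex numbers to reals; convexity on the integers *)

Lemma Re_le (R : realType) (x y : R[i]) :
  x <= y -> complex.Re x <= complex.Re y.
Proof. by rewrite lecE => /andP[]. Qed.

Lemma ge0_complexP (R : realType) (x : R[i]) :
  0 <= x -> exists2 r : R, 0 <= r & x = (r%:C)%C.
Proof.
move=> x0; have xE : x = ((complex.Re x)%:C)%C by rewrite RRe_real// ger0_real.
by exists (complex.Re x) => //; rewrite -ler0c -xE.
Qed.

(** Nonnegative elements of [R[i]] are real, so the Archimedean property of [R] applies. *)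
Lemma mulrn_bounded_eq0 (R : realType) (x y : R[i]) :
  0 <= x -> (forall N, x *+ N <= y) -> x = 0.
Proof.
move=> x0 xy; have y0 : 0 <= y by rewrite -(mulr0n x).
have [r r0 xE] := ge0_complexP x0; have [s s0 yE] := ge0_complexP y0.
move: r0; rewrite le_eqVlt => /predU1P[r0|r0]; first by rewrite xE -r0.
have := archi_boundP (divr_ge0 s0 (ltW r0)); set N := Num.bound _.
rewrite ltr_pdivrMr// mulrC mulr_natr ltNge -lecR rmorphMn /= -xE -yE.
by rewrite xy.
Qed.

Lemma convex_bounded_constant (R : realType) (a : int -> R) (M : R) :
  (forall n, a n <= M) ->
  (forall n, 0 <= a (n - 2) - a (n - 1) *+ 2 + a n) ->
  forall n, a (n - 1) = a n.
Proof.
move=> aM aconv n; apply/eqP; rewrite eq_le; apply/andP; split.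
(* Stepping left from [n] gives [a (n - 1) <= a n]. *)
- have := @convex_bounded_le _ (fun k : nat => a (n - k%:Z)) M.
  rewrite subr0; apply => // k.
  have := aconv (n - k%:Z).
  rewrite (_ : n - k%:Z - 2 = n - k.+2%:Z); last lia.
  by rewrite (_ : n - k%:Z - 1 = n - k.+1%:Z); last lia.
(* Stepping right from [n - 1] gives the reverse inequality. *)
- have := @convex_bounded_le _ (fun k : nat => a (n - 1 + k%:Z)) M.
  rewrite addr0 subrK; apply => // k.
  have := aconv (n - 1 + k.+2%:Z).
  rewrite (_ : n - 1 + k.+2%:Z - 2 = n - 1 + k%:Z); last lia.
  rewrite (_ : n - 1 + k.+2%:Z - 1 = n - 1 + k.+1%:Z); last lia.
  lra.
Qed.

Lemma convex_bounded_constantC (R : realType) (a : int -> R[i]) (M : R[i]) :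
  (forall n, 0 <= a n <= M) ->
  (forall n, 0 <= a (n - 2) - a (n - 1) *+ 2 + a n) ->
  forall n, a (n - 1) = a n.
Proof.
move=> aM aconv n.
have aE k : a k = ((complex.Re (a k))%:C)%C.
  by rewrite RRe_real// ger0_real//; case/andP: (aM k).
rewrite aE [RHS]aE; congr (_%:C)%C.
apply: (@convex_bounded_constant _ (fun k => complex.Re (a k))
  (complex.Re M)) => k.
  by apply: Re_le; case/andP: (aM k).
rewrite -ler0c rmorphD rmorphB rmorphMn /= -!aE.
exact: aconv.
Qed.

(** * Geometry of the bilateral shift *)

(** A nonzero [z] would be closer to some [u] in the span than to 0, which Pythagoras forbids since
    [z] is orthogonal to [u]. *)
Lemma dense_span_orthogonal (R : realType) (H : completeNormedModType R[i])
    (dot : {dot H for conjC}) (e : int -> H) (z : H) :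
  induces_norm dot -> orthonormal_basis dot e ->
  (forall n, dot z (e n) = 0) -> z = 0.
Proof.
move=> Hdot [_ ecl] ze; apply/eqP; apply: contraT => z0.
have : closure (lin_span e) z by rewrite ecl.
rewrite -normr_gt0 in z0 => /(_ _ (nbhsx_ballx z _ z0)) [_ [[s [a ->]]]].
set u := \sum_(n <- s) _; rewrite -ball_normE /= => zu.
have zu0 : dot z u = 0.
  by rewrite dot_sumr big1// => n _; rewrite dotZr ze mulr0.
have : `|z - u| ^+ 2 < `|z| ^+ 2 by rewrite ltrXn2r.
rewrite !Hdot dnormB zu0 conjC0 addr0 subr0.
by rewrite gtrDl (le_gtF (dnorm_ge0 _ _)).
Qed.

Lemma shift_isometry (R : realType) (H : completeNormedModType R[i])
    (dot : {dot H for conjC}) (U : {linear H -> H}) (e : int -> H) :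
  induces_norm dot -> bounded_operator U -> orthonormal_basis dot e ->
  (forall n, U (e n) = e (n + 1)) -> forall x, `|U x| = `|x|.
Proof.
move=> Hdot [M UM] [eo ecl] Ue.
apply: (@eq_on_dense _ _ _ _ _ _ _ _ ecl).
- move=> x; apply: continuous_comp; last exact: norm_continuous.
  exact: bounded_continuous UM x.
- exact: norm_continuous.
move=> _ [s [a ->]]; apply/eqP.
have -> : U (\sum_(n <- s) a n *: e n) = \sum_(n <- s) a n *: e (n + 1).
  by rewrite linear_sum; apply: eq_bigr => n _; rewrite linearZ /= Ue.
rewrite -(@eqrXn2 _ 2)// !Hdot.
(* The term-by-term comparison of double sums remains valid when [s] repeats an index. *)
rewrite !dot_sum; apply/eqP; apply: eq_bigr => i _; apply: eq_bigr => j _.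
by rewrite !eo (inj_eq (addIr _)).
Qed.

Lemma shift_surjective (R : realType) (H : completeNormedModType R[i])
    (dot : {dot H for conjC}) (U : {linear H -> H}) (e : int -> H) :
  induces_norm dot -> bounded_operator U -> orthonormal_basis dot e ->
  (forall n, U (e n) = e (n + 1)) -> forall y, exists x, U x = y.
Proof.
move=> Hdot Ub eb Ue.
apply: (@isometry_dense_range_surj _ _ _ _ _ eb.2).
  exact: shift_isometry Hdot Ub eb Ue.
move=> _ [s [a ->]]; exists (\sum_(n <- s) a n *: e (n - 1)).
by rewrite linear_sum; apply: eq_bigr => n _; rewrite linearZ /= Ue subrK.
Qed.

(** Two vectors representing the same functional differ by a vector orthogonal to itself, so [xget]
    can only pick [y]. *)
Lemma adjoint_isometry (R : realType) (H : completeNormedModType R[i])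
    (dot : {dot H for conjC}) (U : {linear H -> H}) (y : H) :
  (forall x, dot (U x) (U y) = dot x y) ->  adjoint dot U (U y) = y.
Proof.
move=> Uy; apply: xget_unique => // z zy; apply/eqP.
rewrite -subr_eq0 -(dnorm_eq0 dot) linearBr subr_eq0 /=.
by rewrite -zy Uy.
Qed.

(** An eigenvalue of an isometry has modulus 1, so all coefficients of [z] have the same modulus;
    Bessel's inequality forces it to be 0. *)
Lemma shift_no_eigenvector (R : realType) (H : completeNormedModType R[i])
    (dot : {dot H for conjC}) (U : {linear H -> H}) (e : int -> H)
    (w : R[i]) (z : H) :
  induces_norm dot -> bounded_operator U -> orthonormal_basis dot e ->
  (forall n, U (e n) = e (n + 1)) -> U z = w *: z -> z = 0.
Proof.
move=> Hdot Ub eb Ue Uz; have [//|z0] := eqVneq z 0.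
have Uiso := shift_isometry Hdot Ub eb Ue.
have Udot : forall x y, dot (U x) (U y) = dot x y.
  by apply: dot_polarization => x; rewrite -!Hdot Uiso.
have w1 : `|w| = 1.
  apply: (@mulIf _ `|z|); first by rewrite normr_eq0.
  by rewrite -normrZ -Uz Uiso mul1r.
have step n : `|dot z (e (n + 1))| = `|dot z (e n)|.
  by rewrite -(Udot z (e n)) Uz Ue dotZl normrM w1 mul1r.
have steps n (k : nat) : `|dot z (e (n + k%:Z))| = `|dot z (e n)|.
  elim: k => [|k IHk]; first by rewrite addr0.
  by rewrite (_ : n + k.+1%:Z = n + k%:Z + 1) ?step//; lia.
apply: (dense_span_orthogonal Hdot eb) => n; apply/eqP.
rewrite -normr_eq0 -sqrf_eq0; apply/eqP.
apply: (@mulrn_bounded_eq0 _ _ (dot z z)) => [|N]; first exact: exprn_ge0.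
have := @bessel _ _ dot (fun k : nat => e (n + k%:Z)) z N.
under eq_bigr do rewrite steps.
rewrite sumr_const card_ord; apply => k l.
by rewrite eb.1 (inj_eq (addrI _)).
Qed.

(** * Bounded orbits of the normal operator *)

(* With [G := lam^-1 *: (T^-1 - mu)], the hypotheses say that [x' = G x] and
   [x'' = G x']. As [G] is normal, [`|G^* G x - x|^2] equals
   [`|G^2 x|^2 - 2 `|G x|^2 + `|x|^2]. *)
Lemma normal_orbit_convexity (C : numClosedFieldType) (V : lmodType C)
    (dot : {dot V for conjC}) (T : {linear V -> V}) (mu lam : C)
    (x x' x'' : V) :
  (forall y z, dot (T y) (T z) = dot y z) ->
  T (mu *: x + lam *: x') = x -> T (mu *: x' + lam *: x'') = x' ->
  let v := T x' - mu^* *: x' - lam^* *: x in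
  dot v v = `|lam| ^+ 2 * (dot x'' x'' - dot x' x' *+ 2 + dot x x).
Proof.
move=> Tdot Tx Tx' v; rewrite {}/v.
have Tx'x : dot (T x') x = mu^* * dot x' x + lam^* * dot x' x'.
  by rewrite -{1}Tx Tdot dotDr !dotZr.
have Tx'x' : dot (T x') x' = mu^* * dot x' x' + lam^* * dot x' x''.
  by rewrite -{2}Tx' Tdot dotDr !dotZr.
have x'x' : dot x' x' = `|mu| ^+ 2 * dot x' x' + `|lam| ^+ 2 * dot x'' x'' +
    (mu * (lam^* * dot x' x'') + (mu * (lam^* * dot x' x''))^*).
  by rewrite -{1}(Tdot x') -{1 2}Tx' !Tdot dnormD !dnormZ dotZl dotZr.
have real_dot (y : V) : (dot y y)^* = dot y y.
  by rewrite conj_Creal// ger0_real// dnorm_ge0.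
rewrite !dnormB dotBl !dnormZ !dotZr dotZl Tdot Tx'x Tx'x'.
rewrite !norm_conjC !conjCK.
rewrite !(rmorphM, rmorphD, rmorphN) /= !(real_dot, conjCK) in x'x' *.
rewrite !normCK in x'x' *.
move: x'x'; set A := dot x' x'; set B := dot x'' x''; set D := dot x x.
set E := dot x' x''; set F := dot x' x => hA.
(* The two sides differ exactly by the difference of the two sides of [hA]. *)
have := subrr A; rewrite {2}hA => h0; apply: subr0_eq; rewrite -[RHS]h0; ring.
Qed.

Lemma shift_orbit_eq0 (R : realType) (H : completeNormedModType R[i])
    (dot : {dot H for conjC}) (U : {linear H -> H}) (e : int -> H)
    (lam : R[i]) (x : int -> H) (M : R[i]) :
  induces_norm dot -> bounded_operator U -> orthonormal_basis dot e ->
  (forall n, U (e n) = e (n + 1)) -> lam != 0 -> lam != 1 ->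
  (forall n, U ((1 - lam) *: x n + lam *: x (n - 1)) = x n) ->
  (forall n, `|x n| <= M) -> forall n, x n = 0.
Proof.
move=> Hdot Ub eb Ue lam0 lam1 xU xM n.
have Uiso := shift_isometry Hdot Ub eb Ue.
have Udot : forall y z, dot (U y) (U z) = dot y z.
  by apply: dot_polarization => y; rewrite -!Hdot Uiso.
set mu := 1 - lam in xU.
have mu0 : mu != 0 by rewrite subr_eq0 eq_sym.
(* In terms of the normal operator [G], [v k] is [lam^*] times [G^* G x_k - x_k]. *)
pose v k := U (x (k - 1)) - mu^* *: x (k - 1) - lam^* *: x k.
pose a k := dot (x k) (x k).
have lam2 : 0 < `|lam| ^+ 2 by rewrite exprn_gt0 ?normr_gt0.
have vE k : dot (v k) (v k) = `|lam| ^+ 2 * (a (k - 2) - a (k - 1) *+ 2 + a k).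
  apply: normal_orbit_convexity => //.
  by have := xU (k - 1); rewrite (_ : k - 1 - 1 = k - 2)//; lia.
have acst : forall k, a (k - 1) = a k.
  apply: (@convex_bounded_constantC _ _ (M ^+ 2)) => k.
    by rewrite dnorm_ge0 /a -Hdot lerXn2r ?nnegrE// (le_trans _ (xM k)).
  by rewrite -(pmulr_rge0 _ lam2) -vE dnorm_ge0.
have v0 : v n = 0.
  apply/eqP; rewrite -(dnorm_eq0 dot) vE.
  have -> : a (n - 2) = a (n - 1) by rewrite -(acst (n - 1)); congr a; lia.
  by rewrite acst mulr2n opprD addrA subrr sub0r addNr mulr0.
have Ux : lam *: U (x (n - 1)) = x n - mu *: U (x n).
  by rewrite -{1}(xU n) linearD !linearZ /= addrAC scalerN subrr add0r.
(* This is [lam *: v n = 0] after eliminating [U (x (n - 1))] by [Ux]. *)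
have xn : (1 - lam * lam^*) *: x n =
    mu *: U (x n) + (mu^* * lam) *: x (n - 1).
  have /eqP : lam *: v n = 0 by rewrite v0 scaler0.
  rewrite /v !scalerBr Ux !scalerA subr_eq0 subr_eq => /eqP xE.
  apply/eqP; rewrite scalerBl scale1r subr_eq -addrA [X in _ == X]addrC.
  by rewrite -subr_eq xE addrC (mulrC lam (mu^*)).
(* Applying [U] to [xn] and using [Ux] again eliminates [x (n - 1)], leaving a quadratic relation in
   [U]. *)
have UUx : mu *: U (U (x n)) =
    (1 - lam * lam^* + mu^* * mu) *: U (x n) - mu^* *: x n.
  have := congr1 U xn; rewrite linearD !linearZ /= -scalerA Ux => UxE.
  by rewrite scalerDl UxE scalerBr scalerA scalerN addrA subrK addrK.
(* As [mu = 1 - lam], the middle coefficient is [mu + mu^*]; hence this vector is fixed by [U]. *)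
have z0 : mu *: U (x n) - mu^* *: x n = 0.
  apply: (shift_no_eigenvector (w := 1) Hdot Ub eb Ue).
  rewrite linearB !linearZ /= UUx scale1r !scalerN addrAC -scalerBl.
  congr (_ *: _ - _).
  rewrite /mu rmorphB rmorph1; ring.
apply: (shift_no_eigenvector (w := mu^* / mu) Hdot Ub eb Ue).
apply: (scalerI mu0).
by rewrite scalerA mulrC divfK//; apply/eqP; rewrite -subr_eq0 z0 eqxx.
Qed.

(** * The operator equation *)

(** [adjoint] is a pointwise choice, not a linear map by construction; writing 0 as [T 0] reduces
    its value there to [adjoint_isometry]. *)
Lemma adjoint0 (R : realType) (H : completeNormedModType R[i])
    (dot : {dot H for conjC}) (T : {linear H -> H}) : adjoint dot T 0 = 0.
Proof.
rewrite -[in LHS](linear0 T); apply: adjoint_isometry => x.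
by rewrite (linear0 T) !linear0r.
Qed.

Theorem theorem9p2 (R : realType) (H : completeNormedModType R[i])
    (dot : {dot H for conjC}) (Hdot : induces_norm dot)
    (U : {linear H -> H}) (HU : bilateral_shift dot U)
    (lambda : R[i]) (Hlambda : lambda <> 1)
    (X : {linear H -> H}) (HX : bounded_operator X) :
  ((idfun \- adjoint dot U) \o X =1
     lambda \*: (X \o (idfun \- adjoint dot U)))
  <-> (X =1 \0).
Proof.
split=> [eqX|X0 x]; last first.
  by rewrite /= !X0 /= scaler0 adjoint0 subr0.
have [Ub [e [eb Ue]]] := HU; have [M XM] := HX.
have Udot : forall x y, dot (U x) (U y) = dot x y.
  apply: dot_polarization => x.
  by rewrite -!Hdot (shift_isometry Hdot Ub eb Ue).
have UV x : U (adjoint dot U x) = x.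
  by have [y <-] := shift_surjective Hdot Ub eb Ue x; rewrite adjoint_isometry.
have Ve n : adjoint dot U (e n) = e (n - 1).
  by rewrite -[in LHS](subrK 1 n) -Ue adjoint_isometry.
(* The equation at [e n] expresses the adjoint applied to [X (e n)]; applying [U] removes the
   adjoint. *)
have XE n : U ((1 - lambda) *: X (e n) + lambda *: X (e (n - 1))) = X (e n).
  have := eqX (e n); rewrite /= Ve linearB /= => XeE.
  rewrite -[RHS]UV; congr (U _).
  rewrite -[RHS](subKr (X (e n))) XeE scalerBl scale1r scalerBr opprB.
  by rewrite addrA addrAC.
have Xe n : X (e n) = 0.
  (* For [lambda = 0] there is no operator [G], but then [XE] says that [U] fixes [X (e n)]. *)
  have [l0|l0] := eqVneq lambda 0.
    apply: (shift_no_eigenvector (w := 1) Hdot Ub eb Ue).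
    by have := XE n; rewrite l0 subr0 !scale1r scale0r addr0.
  apply: (shift_orbit_eq0 (M := M) Hdot Ub eb Ue l0 _ XE) => [|k].
    exact/eqP.
  apply: le_trans (XM _) _.
  suff -> : `|e k| = 1 by rewrite mulr1.
  by apply/eqP; rewrite -(@eqrXn2 _ 2)// Hdot eb.1 eqxx expr1n.
apply: (@eq_on_dense _ _ _ _ _ _ _ _ eb.2).
- exact: bounded_continuous XM.
- exact: cst_continuous.
move=> _ [s [a ->]]; rewrite linear_sum big1// => n _.
by rewrite linearZ /= Xe scaler0.
Qed.
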